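(* Let $P$ be a finite poset with $|P|\ge 2$ whose Hasse diagram is connected, and let $r$ be a positive integer. Then $P$ has an $r$-Gorenstein labeling if and only if each biconnected component of $P$ has an $r$-Gorenstein labeling.
   Context: A biconnected component of $P$ is a maximal biconnected subgraph (block) of the undirected Hasse diagram of $P$, regarded as the subposet of $P$ induced on its vertex set. For a poset $Q$ and $S\subseteq Q$, $cc(S)$ is the number of connected components of the subgraph of the undirected Hasse diagram of $Q$ induced on $S$ ($cc(\varnothing)=0$); for an upset $A$ of $Q$, $\dim(A)=cc(A)+cc(Q\setminus A)-1$. An $r$-Gorenstein labeling of $Q$ is $\phi:Q\to\mathbb{Z}$ with $\sum_{z\in Q}\phi(z)=0$ and $\sum_{z\in A}\phi(z)=r$ for every upset $A$ of $Q$ with $\dim(A)=1$. *)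

(* Defs.v *)
From HB Require Import structures.
From mathcomp Require Import all_boot all_order all_algebra.
Set Implicit Arguments.
Unset Strict Implicit.
Unset Printing Implicit Defensive.

(* Finite simple graphs on vertices taken from T; an edge is the unordered pair
   [set x; y]. *)
Record graph (T : finType) := Graph {
  vertices : {set T};
  edges : {set {set T}}
}.

Section Graphs.
Variable T : finType.
Implicit Types (G H : graph T) (S : {set T}).

Definition adj G : rel T := fun x y =>
  [&& x \in vertices G, y \in vertices G & [set x; y] \in edges G].

Definition induced G S : graph T :=
  Graph (vertices G :&: S) [set e in edges G | e \subset S].

(* vertices G is closed under adj G, so n_comp does count the components. *)
Definition num_components G : nat := n_comp (adj G) (vertices G).

Definition connected_graph G : Prop :=
  vertices G != set0 /\ {in vertices G &, forall x y, connect (adj G) x y}.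

(* The last conjunct says that there is no cut vertex. In particular a single
   edge is biconnected, so that bridges are blocks. *)
Definition biconnected G : Prop :=
  connected_graph G /\
  forall v, v \in vertices G ->
    {in vertices G :\ v &,
       forall x y, connect (adj (induced G (vertices G :\ v))) x y}.

Definition subgraph H G : Prop :=
  [/\ vertices H \subset vertices G,
      edges H \subset edges G
    & forall e, e \in edges H -> e \subset vertices H].

Definition is_block G H : Prop :=
  [/\ subgraph H G,
      biconnected H
    & forall H', subgraph H' G -> biconnected H' -> subgraph H H' -> H' = H].

End Graphs.

(* The subposets Q of P are represented by their underlying subsets, P itself
   being [set: P]. *)
Section Posets.
Import Order.Theory GRing.Theory.
Variables (d : Order.disp_t) (P : finPOrderType d).
Implicit Types (Q A S : {set P}) (x y z : P).
Local Open Scope order_scope.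

Definition covered_in Q x y : bool :=
  [&& x \in Q, y \in Q, x < y & [forall z in Q, ~~ (x < z < y)]].

(* The order is the one of the subposet Q, so that x < y may be joined in
   hasse Q although some z outside of Q lies between them. *)
Definition hasse Q : graph P :=
  Graph Q [set [set x; y] | x in Q, y in Q & covered_in Q x y].

Definition is_upset Q A : Prop :=
  A \subset Q /\ forall x y, x \in A -> y \in Q -> x <= y -> y \in A.

Definition cc Q S : nat := num_components (induced (hasse Q) S).

Definition upset_dim Q A : int := ((cc Q A + cc Q (Q :\: A))%N%:Z - 1)%R.

(* Only the values of phi on Q matter. *)
Definition gorenstein_labeling Q (r : int) (phi : P -> int) : Prop :=
  (\sum_(z in Q) phi z = 0)%R /\
  forall A, is_upset Q A -> upset_dim Q A = 1%R ->
    (\sum_(z in A) phi z = r)%R.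

Definition has_gorenstein_labeling Q (r : int) : Prop :=
  exists phi : P -> int, gorenstein_labeling Q r phi.

End Posets.

(* Main.v *)
(* For A nonempty and proper, dim A = 1 says that A and its complement are both
   connected. A simple path joining two distinct vertices of a block stays in
   the block (ear argument); hence blocks are convex, their Hasse diagrams are
   induced, and a connected A meets each block in a connected set.
   Labelings of the blocks are added up: the edges between A and its complement
   form a bond, so they lie in one block B0, and every other block is inside A
   or disjoint from A and contributes 0. Conversely, a labeling of P is pushed
   onto a block B by collapsing to v the part of P that hangs at v, i.e. that
   is reachable from v without the edges of B; the preimage of an upset of B
   under this collapse is an upset of P, and connectedness is preserved. *)
Require Import Defs.
From HB Require Import structures.
From mathcomp Require Import all_boot all_order all_algebra.
Set Implicit Arguments.
Unset Strict Implicit.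
Unset Printing Implicit Defensive.

(** * Blocks of a symmetric relation, as maximal biconnected vertex sets *)

Section Blocks.
Variables (T : finType) (e : rel T).
Hypothesis e_sym : symmetric e.
Implicit Types (S B A D : {set T}) (x y z v : T) (p : seq T).

Definition within S : rel T := fun x y => [&& x \in S, y \in S & e x y].
Arguments within S x y /.

Definition linked S : bool :=
  [forall x in S, forall y in S, connect (within S) x y].

Definition bicon S : bool :=
  [&& S != set0, linked S & [forall v in S, linked (S :\ v)]].

Definition block S : bool := maxset bicon S.

Lemma linkedP S :
  reflect {in S &, forall x y, connect (within S) x y} (linked S).
Proof.
apply: (iffP forall_inP) => [H x y xS yS | H x xS].
  by move/forall_inP: (H x xS); apply.
by apply/forall_inP => y; apply: H.
Qed.

Lemma within_sym S : symmetric (within S).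
Proof. by move=> x y; rewrite /= e_sym andbCA. Qed.

Lemma connect_within_sym S x y :
  connect (within S) x y = connect (within S) y x.
Proof. exact: sym_connect_sym (@within_sym S) x y. Qed.

Lemma connect_withinW S S' x y : S \subset S' ->
  connect (within S) x y -> connect (within S') x y.
Proof.
move=> /subsetP sSS'; apply: connect_sub => {}x {}y /= /and3P[xS yS xy].
by apply: connect1; rewrite /= !sSS'.
Qed.

(** Two points of [D] are joined by way of the hub [S]; connected sets are enlarged in this way
    below. *)
Lemma linked_hub S D : S \subset D -> linked S ->
  (forall z, z \in D -> exists2 s, s \in S & connect (within D) z s) ->
  linked D.
Proof.
move=> sSD /linkedP lS H; apply/linkedP => x y /H[s sS xs] /H[t tS yt].
apply: connect_trans xs _; rewrite connect_within_sym.
apply: connect_trans yt _; rewrite connect_within_sym.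
exact: connect_withinW sSD (lS _ _ sS tS).
Qed.

Lemma linkedU S1 S2 z : linked S1 -> linked S2 -> z \in S1 -> z \in S2 ->
  linked (S1 :|: S2).
Proof.
move=> l1 /linkedP l2 z1 z2; apply: (linked_hub (subsetUl _ _) l1) => x.
rewrite in_setU => /orP[x1 | x2]; first by exists x.
by exists z => //; apply: connect_withinW (subsetUr _ _) (l2 _ _ x2 z2).
Qed.

Lemma bicon_linkedD1 S v : bicon S -> linked (S :\ v).
Proof.
case/and3P=> _ lS /forall_inP H; have [vS | vS] := boolP (v \in S).
  exact: H.
by have /setDidPl-> : [disjoint S & [set v]] by rewrite disjoint_sym disjoints1.
Qed.

(** Whichever [v] is deleted, one of the shared points [x], [y] survives and glues the two
    remainders. *)
Lemma biconU S1 S2 x y : bicon S1 -> bicon S2 -> x != y ->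
  x \in S1 -> x \in S2 -> y \in S1 -> y \in S2 -> bicon (S1 :|: S2).
Proof.
move=> b1 b2 nxy x1 x2 y1 y2.
have [/and3P[_ l1 _] /and3P[_ l2 _]] := (b1, b2).
apply/and3P; split; first by apply/set0Pn; exists x; rewrite inE x1.
  exact: linkedU x1 x2.
apply/forall_inP => v _; rewrite setDUl.
have l1v := bicon_linkedD1 v b1; have l2v := bicon_linkedD1 v b2.
have [xv | nxv] := eqVneq x v.
  by apply: (linkedU (z := y)); rewrite // !inE -xv eq_sym nxy.
by apply: (linkedU (z := x)); rewrite // !inE nxv.
Qed.

Lemma block_bicon B : block B -> bicon B.
Proof. exact: maxsetp. Qed.

Lemma block_linked B : block B -> linked B.
Proof. by case/block_bicon/and3P. Qed.

(** By maximality both blocks equal their union; so distinct blocks share at most one vertex. *)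
Lemma block_eq B1 B2 x y : block B1 -> block B2 -> x != y ->
  x \in B1 -> x \in B2 -> y \in B1 -> y \in B2 -> B1 = B2.
Proof.
move=> bl1 bl2 nxy x1 x2 y1 y2.
have bU := biconU (block_bicon bl1) (block_bicon bl2) nxy x1 x2 y1 y2.
rewrite -(maxsetsup bl1 bU (subsetUl _ _)).
exact: maxsetsup bl2 bU (subsetUr _ _).
Qed.

Lemma path_connect_within S x p : path e x p -> {subset x :: p <= S} ->
  connect (within S) x (last x p).
Proof.
elim: p x => [|y p IHp] x //= /andP[xy yp] sub.
apply: (connect_trans (y := y)).
  by apply: connect1; rewrite /= !sub ?inE ?eqxx ?orbT.
by apply: IHp => // z zp; apply: sub; rewrite inE zp orbT.
Qed.

Lemma connect_within_path S x y : x \in S -> connect (within S) x y ->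
  exists p, [/\ path e x p, last x p = y, uniq (x :: p) & {subset x :: p <= S}].
Proof.
move=> xS /connectP[p /shortenP[q xq uq _] ->]; exists q; split=> //.
  by apply: sub_path xq => u v /and3P[].
elim: q x xS xq {uq} => [|z q IHq] x xS /=.
  by move=> _ t; rewrite inE => /eqP->.
case/andP=> /and3P[_ zS _] zq t; rewrite inE => /predU1P[-> // | ].
exact: IHq.
Qed.

(* Splitting the path at z, the vertex v misses one of the two halves. *)
Lemma uniq_path_avoid S x p z v : path e x p -> uniq (x :: p) ->
  {subset x :: p <= S} -> z \in p -> z != v ->
  exists2 t, (t == x) || (t == last x p)
           & (t != v) && connect (within (S :\ v)) z t.
Proof.
move=> + + + zp; case/path.splitP: zp => p1 p2.
rewrite cat_path last_rcons last_cat last_rcons => /andP[xp1 zp2] up sub nzv.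
have [vp2 | vp2] := boolP (v \in z :: p2).
  exists x; rewrite ?eqxx //; have vn : v \notin x :: rcons p1 z.
    move: up; rewrite -cat_cons cat_uniq => /and3P[_ /hasPn H _].
    move: vp2; rewrite inE eq_sym (negPf nzv) => /H //.
  apply/andP; split.
    by apply: contraNneq vn => ->; rewrite inE eqxx.
  rewrite connect_within_sym -(last_rcons x p1 z).
  apply: path_connect_within => // t tp; rewrite !inE; apply/andP; split.
    by apply: contraNneq vn => <-.
  by apply: sub; rewrite -cat_cons mem_cat tp.
exists (last z p2); rewrite ?eqxx ?orbT //; apply/andP; split.
  by apply: contraNneq vp2 => <-; apply: mem_last.
apply: path_connect_within => // t tp; rewrite !inE; apply/andP; split.
  by apply: contraNneq vp2 => <-.
apply: sub; rewrite inE mem_cat mem_rcons.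
by rewrite inE in tp; rewrite inE; case/orP: tp => ->; rewrite ?orbT.
Qed.

(** Adjoining the path keeps [B] biconnected: once [v] is deleted, each remaining path vertex still
    reaches an end of the path other than [v], hence [B]. Maximality of [B] then absorbs the
    path. *)
Lemma block_ear B x p : block B -> path e x p -> uniq (x :: p) ->
  x \in B -> last x p \in B -> x != last x p -> {subset x :: p <= B}.
Proof.
move=> blB xp up xB yB nxy; set D := B :|: [set z in p].
have sBD : B \subset D by apply: subsetUl.
have subD : {subset x :: p <= D}.
  by move=> z; rewrite !inE => /predU1P[-> | ->]; rewrite ?xB ?orbT.
have bB := block_bicon blB.
suff bD : bicon D by move=> z /subD; rewrite (maxsetsup blB bD sBD).
apply/and3P; split; first by apply/set0Pn; exists x; rewrite subD ?inE ?eqxx.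
  apply: (linked_hub sBD (block_linked blB)) => z.
  rewrite !inE => /orP[zB | zp]; first by exists z.
  exists x => //; rewrite connect_within_sym.
  case/path.splitP: zp xp subD => p1 p2; rewrite cat_path => /andP[xp1 _] subD.
  rewrite -[z in connect _ _ z](last_rcons x p1 z).
  apply: path_connect_within => // t tp.
  by apply: subD; rewrite -cat_cons mem_cat tp.
apply/forall_inP => v _.
apply: (linked_hub (setSD _ sBD) (bicon_linkedD1 v bB)) => z.
rewrite !inE => /andP[nzv /orP[zB | zp]].
  by exists z => //; rewrite !inE nzv.
have [t t_xy /andP[ntv zt]] := uniq_path_avoid xp up subD zp nzv.
by exists t => //; rewrite !inE ntv; case/orP: t_xy => /eqP->.
Qed.

Lemma block_edge x y : e x y -> exists B, [/\ block B, x \in B & y \in B].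
Proof.
move=> xy; have bxy : bicon [set x; y].
  apply/and3P; split; first by apply/set0Pn; exists x; rewrite !inE eqxx.
    apply/linkedP => u v; rewrite !inE => /orP[]/eqP-> /orP[]/eqP-> //;
      by apply: connect1; rewrite /= !inE !eqxx ?orbT //= e_sym.
  apply/forall_inP => w wxy; apply/linkedP => u v.
  (* Deleting an end of the edge leaves at most one vertex. *)
  suff H t1 t2 : t1 \in [set x; y] :\ w -> t2 \in [set x; y] :\ w -> t1 = t2.
    by move=> uS vS; rewrite (H u v).
  move: wxy; rewrite !inE => /orP[]/eqP->.
    by do 2!move=> /andP[/negPf-> /= /eqP->].
  by do 2!(rewrite [_ || _]orbC => /andP[/negPf-> /= /eqP->]).
have [B blB /subsetP sB] := maxset_exists bxy.
by exists B; split=> //; apply: sB; rewrite !inE eqxx ?orbT.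
Qed.

(** A simple path inside [A] between two vertices of [B] is an ear, so it lies in both sets. *)
Lemma linked_setI_block B A : block B -> linked A -> linked (A :&: B).
Proof.
move=> blB /linkedP lA; apply/linkedP => x y /setIP[xA xB] /setIP[yA yB].
have [-> // | nxy] := eqVneq x y.
have [p [xp lp up sA]] := connect_within_path xA (lA x y xA yA).
rewrite -lp in nxy yB *; apply: path_connect_within => // z zp.
by rewrite inE sA //= (block_ear blB xp up).
Qed.

Lemma linked_cross S A x y : linked S -> x \in S -> y \in S -> x \in A ->
  y \notin A ->
  exists u v, [/\ e u v, u \in S, v \in S, u \in A & v \notin A].
Proof.
move=> /linkedP lS xS yS xA yA.
have [p [xp lp _ sS]] := connect_within_path xS (lS x y xS yS).
rewrite -{}lp in yA {yS}; elim: p x xA xp sS yA {xS} => [|z p IHp] x xA /=.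
  by rewrite xA.
case/andP=> xz zp sS; have [zA | zA] := boolP (z \in A).
  by apply: IHp => // t tp; apply: sS; rewrite inE tp orbT.
by move=> _; exists x, z; rewrite xA zA xz !sS // !inE eqxx ?orbT.
Qed.

(* An edge bb' across the cut closes, with aa' and a path on either side, a
   cycle; hence all the edges across the cut lie in one block. *)
Lemma block_of_bond A B a a' b b' : linked A -> linked (~: A) ->
  a \in A -> a' \notin A -> block B -> a \in B -> a' \in B ->
  b \in A -> b' \notin A -> e b b' -> (b \in B) && (b' \in B).
Proof.
move=> /linkedP lA /linkedP lC aA aA' blB aB aB' bA bA' bb'.
have [p [ap lp up sp]] := connect_within_path aA (lA a b aA bA).
have bC : b' \in ~: A by rewrite inE.
have aC : a' \in ~: A by rewrite inE.
have [q [bq lq uq sq]] := connect_within_path bC (lC b' a' bC aC).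
have sub : {subset a :: (p ++ b' :: q) <= B}.
  apply: block_ear => //.
  - by rewrite cat_path ap /= lp bb'.
  - rewrite -cat_cons cat_uniq up uq andbT; apply/hasPn => t /sq.
    by rewrite inE; apply: contra => /sp.
  - by rewrite last_cat /= lq.
  by rewrite last_cat /= lq; apply: contraNneq aA' => <-.
rewrite !sub ?inE ?mem_cat ?inE ?eqxx ?orbT //.
by rewrite orbA -in_cons -lp mem_last.
Qed.

(** * Collapsing the whole vertex set onto a block *)

Section Hanging.

Variable B : {set T}.
Hypotheses (blB : block B) (e_conn : linked [set: T]).

(** Only the edges inside [B] are removed, no vertices; each component of what remains contains
    exactly one vertex of [B], by [anchor_exists] and [outer_inj]. *)
Definition outer : rel T := fun x y => e x y && ~~ ((x \in B) && (y \in B)).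
Arguments outer x y /.

(** The default [z] is never taken, by [anchor_exists]. *)
Definition anchor z : T := odflt z [pick v in B | connect outer v z].

Lemma outer_sym x y : connect outer x y = connect outer y x.
Proof.
apply: sym_connect_sym x y => x y.
by rewrite /outer /= e_sym [(x \in B) && _]andbC.
Qed.

Lemma anchor_exists z : exists2 v, v \in B & connect outer v z.
Proof.
have /set0Pn[v0 v0B] : B != set0 by case/and3P: (block_bicon blB).
have /connectP[p] := (linkedP _ e_conn v0 z (in_setT _) (in_setT _)).
elim/last_ind: p z => [|p z IHp] w; first by move=> _ ->; exists v0.
move=> + ->.
rewrite rcons_path last_rcons => /andP[/IHp /(_ erefl)[v vB vl]].
case/and3P=> _ _ lz; set l := last v0 p in vl lz.
(* Along a path from [v0], an edge inside [B] ends at a vertex of [B], which serves as its own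
   anchor; any other edge prolongs the outer path. *)
have [/andP[_ zB] | nB] := boolP ((l \in B) && (z \in B)); first by exists z.
by exists v => //; apply: connect_trans vl _; apply: connect1; rewrite /= lz.
Qed.

Lemma anchor_in z : anchor z \in B.
Proof.
rewrite /anchor; case: pickP => [v /andP[] // | H].
by have [v vB vz] := anchor_exists z; have:= H v; rewrite /= vB vz.
Qed.

Lemma anchor_connect z : connect outer (anchor z) z.
Proof.
rewrite /anchor; case: pickP => [v /andP[] // | H].
by have [v vB vz] := anchor_exists z; have:= H v; rewrite /= vB vz.
Qed.

(** A nontrivial outer path between vertices of [B] would be an ear, and its first edge would lie
    inside [B]. *)
Lemma outer_inj u v : u \in B -> v \in B -> connect outer u v -> u = v.
Proof.
move=> uB vB /connectP[p /shortenP[q uq Uq _] lq]; rewrite {}lq in vB *.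
case: q uq Uq vB => [|w q] // uq Uq vB.
have eq : path e u (w :: q) by apply: sub_path uq => ? ? /andP[].
have nuw : u != last u (w :: q).
  by apply: contraTneq Uq => ->; rewrite /= mem_last.
have wB := block_ear blB eq Uq uB vB nuw.
by case/andP: uq => /andP[_]; rewrite !wB // !inE eqxx ?orbT.
Qed.

Lemma anchor_eq u z : u \in B -> connect outer u z -> anchor z = u.
Proof.
move=> uB uz; apply: outer_inj => //; first exact: anchor_in.
by apply: connect_trans (anchor_connect z) _; rewrite outer_sym.
Qed.

Lemma anchor_id u : u \in B -> anchor u = u.
Proof. by move=> uB; apply: anchor_eq. Qed.

Lemma anchor_edge x y : e x y ->
  anchor x = anchor y \/ [/\ x \in B, y \in B, anchor x = x & anchor y = y].
Proof.
move=> xy; have [/andP[xB yB] | nB] := boolP ((x \in B) && (y \in B)).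
  by right; rewrite !anchor_id.
left; apply/esym/anchor_eq; first exact: anchor_in.
by apply: connect_trans (anchor_connect x) _; apply: connect1; rewrite /= xy.
Qed.

(** The outer path from [anchor z] to [z] has constant anchor, so it stays in the preimage and ties
    [z] to the hub [S]. *)
Lemma linked_anchor_preim S : S \subset B -> linked S ->
  linked [set z | anchor z \in S].
Proof.
move=> sSB lS; apply: (@linked_hub S) => //.
  by apply/subsetP=> z zS; rewrite inE anchor_id // (subsetP sSB).
move=> z; rewrite inE => zS; exists (anchor z) => //.
rewrite connect_within_sym; have /connectP[p] := anchor_connect z.
elim/last_ind: p z zS => [|p z IHp] t tS /=.
  by move=> _ zt; rewrite -zt.
rewrite rcons_path last_rcons => /andP[ap lz] tz; rewrite {t}tz in tS ap lz *.
set l := last _ p in lz; have al : anchor l = anchor z.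
  apply: anchor_eq; first exact: anchor_in.
  by apply/connectP; exists p.
apply: (connect_trans (y := l)).
  by rewrite -al; apply: IHp; rewrite ?al.
by apply: connect1; rewrite /= !inE al tS /=; case/andP: lz.
Qed.

End Hanging.

End Blocks.

Arguments within {T} e S x y /.

(** * Block subgraphs versus vertex sets, and counting components *)

Section GraphBlocks.

Variables (T : finType) (G : graph T).
Implicit Types (S : {set T}) (H : graph T).

Lemma adj_sym H : symmetric (adj H).
Proof. by move=> x y; rewrite /adj andbCA setUC. Qed.

Lemma adj_induced H S : adj (induced H S) =2 within (adj H) S.
Proof.
move=> x y; rewrite /within /adj /= !inE subUset !sub1set.
by case: (x \in S); case: (y \in S); rewrite ?andbT ?andbF.
Qed.

Lemma subgraph_adj H : subgraph H G -> subrel (adj H) (adj G).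
Proof.
case=> /subsetP sV /subsetP sE _ x y /and3P[/sV xV /sV yV /sE xyE].
by rewrite /adj xV yV xyE.
Qed.

(** [H] need not be induced, but the further edges of [G] can only help connectivity. *)
Lemma bicon_vertices H : subgraph H G -> biconnected H ->
  bicon (adj G) (vertices H).
Proof.
move=> sHG [[V0 cH] bH]; apply/and3P; split=> //.
  apply/linkedP => x y xV yV; apply: connect_sub (cH x y xV yV) => u v uv.
  apply: connect1; rewrite /= (subgraph_adj sHG uv) andbT.
  by case/and3P: uv => -> ->.
apply/forall_inP => v vV; apply/linkedP => x y xV yV.
apply: connect_sub (bH v vV x y xV yV) => u w.
rewrite adj_induced => /and3P[uV wV uw].
by apply: connect1; rewrite /= uV wV (subgraph_adj sHG uw).
Qed.

Hypothesis G_total : vertices G = [set: T].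

Lemma induced_subgraph S : subgraph (induced G S) G.
Proof.
split=> /= [||e]; first exact: subsetIl.
  by apply/subsetP=> e; rewrite inE => /andP[].
by rewrite inE G_total setTI => /andP[].
Qed.

Lemma biconnected_induced S : bicon (adj G) S -> biconnected (induced G S).
Proof.
case/and3P=> S0 /linkedP lS /forall_inP l1S; split.
  split=> /=; rewrite G_total setTI // => x y xS yS.
  by rewrite (eq_connect (adj_induced G S)) lS.
move=> v; rewrite /= G_total setTI => /l1S/linkedP lv x y xS yS.
rewrite (eq_connect (@adj_induced _ _)).
apply: connect_sub (lv x y xS yS) => u w /and3P[uS wS uw].
apply: connect1; rewrite /= uS wS adj_induced /= uw.
by move: uS wS; rewrite !inE => /andP[_ ->] /andP[_ ->].
Qed.

(** A biconnected [S] containing [vertices H] gives an induced subgraph above [H], which maximality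
    identifies with [H]. *)
Lemma is_block_vertices H : is_block G H -> block (adj G) (vertices H).
Proof.
case=> sHG bH maxH; apply/maxsetP; split=> [|S bS sHS].
  exact: bicon_vertices.
have eHS := maxH _ (induced_subgraph S) (biconnected_induced bS).
rewrite -eHS /= ?G_total ?setTI //.
case: (sHG) => _ sE sV; split; rewrite /= ?G_total ?setTI //.
apply/subsetP => e eH; rewrite inE (subsetP sE) //=.
exact: subset_trans (sV e eH) sHS.
Qed.

(** Maximality of [S] fixes the vertices of a larger biconnected subgraph; its edges then lie inside
    [S] and are already in [induced G S]. *)
Lemma block_is_block S : block (adj G) S -> is_block G (induced G S).
Proof.
move=> blS; split; first exact: induced_subgraph.
  exact: biconnected_induced (block_bicon blS).
move=> [V E] sHG bH [/= sV sE _]; rewrite G_total setTI in sV *.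
have eV : V = S := maxsetsup blS (bicon_vertices sHG bH) sV.
rewrite eV /induced G_total setTI; congr Graph.
apply/eqP; rewrite eqEsubset sE andbT.
case: sHG => /= _ /subsetP sEG sEV; apply/subsetP => e eE.
by rewrite inE sEG //= -eV sEV.
Qed.

Lemma num_components0 H : vertices H = set0 -> num_components H = 0.
Proof.
move=> V0; rewrite /num_components V0 /n_comp_mem; apply: eq_card0 => x.
by rewrite !inE andbF.
Qed.

Lemma adj_closed H : closed (adj H) (vertices H).
Proof. by move=> x y /and3P[-> ->]. Qed.

Lemma num_components_gt0 H : vertices H != set0 -> (0 < num_components H)%N.
Proof.
case/set0Pn=> x xV; rewrite /num_components /n_comp_mem; apply/card_gt0P.
have csym := sym_connect_sym (adj_sym H).
exists (fingraph.root (adj H) x); rewrite !inE roots_root //=.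
by rewrite -(closed_connect (@adj_closed H) (connect_root _ x)).
Qed.

Lemma num_components1 H : vertices H != set0 ->
  (num_components H == 1) <->
  {in vertices H &, forall x y, connect (adj H) x y}.
Proof.
move=> V0; have csym := sym_connect_sym (adj_sym H).
have rootV x : x \in vertices H ->
    fingraph.root (adj H) x \in predI (roots (adj H)) (mem (vertices H)).
  move=> xV; rewrite !inE roots_root //=.
  by rewrite -(closed_connect (@adj_closed H) (connect_root _ x)).
rewrite /num_components; split=> [/eqP n1 x y xV yV | cH].
  rewrite /n_comp_mem in n1; rewrite -(root_connect csym).
  (* Components are counted by their roots, and two roots in a set of one element coincide. *)
  apply/eqP/(card_le1_eqP (eq_leq n1)); exact: rootV.
(* Conversely, the vertex set is the component of [x]. *)
case/set0Pn: V0 => x xV; rewrite -(n_comp_connect csym x); apply/eqP.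
apply: eq_n_comp_r => y; rewrite inE; apply/idP/idP => [|xy]; first exact: cH.
by rewrite -(closed_connect (@adj_closed H) xy).
Qed.

End GraphBlocks.

(** * Hasse diagrams, covers and labelings *)

Section Hasse.

Import Order.Theory GRing.Theory.
Variables (d : Order.disp_t) (P : finPOrderType d).
Implicit Types (Q A B S : {set P}) (x y z : P).
Local Open Scope order_scope.

Notation cover := (covered_in [set: P]).
Notation hadj := (adj (hasse [set: P])).

Lemma adj_hasse Q x y :
  adj (hasse Q) x y = covered_in Q x y || covered_in Q y x.
Proof.
rewrite /adj /=; apply/and3P/orP => [[xQ yQ /imset2P[a b aQ]] | H].
  rewrite inE => /andP[bQ ab] eab.
  have /set2P[ex | ex] : x \in [set a; b] by rewrite -eab set21.
    have /set2P[ey | ey] : y \in [set a; b] by rewrite -eab set22.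
      have : b \in [set x; y] by rewrite eab set22.
      by rewrite ex ey !inE orbb => /eqP eba; left; rewrite -{2}eba.
    by left; rewrite ex ey.
  have /set2P[ey | ey] : y \in [set a; b] by rewrite -eab set22.
    by right; rewrite ex ey.
  have : a \in [set x; y] by rewrite eab set21.
  by rewrite ex ey !inE orbb => /eqP eba; left; rewrite -{1}eba.
case: H => xy; case/and4P: (xy) => xQ yQ _ _; split=> //.
  by apply/imset2P; exists x y; rewrite ?inE ?xQ ?yQ.
by apply/imset2P; exists y x; rewrite ?inE ?xQ ?yQ // setUC.
Qed.

Lemma cover_adj : subrel cover hadj.
Proof. by move=> x y xy; rewrite adj_hasse xy. Qed.

Lemma cover_lt : subrel cover <%O.
Proof. by move=> x y /and4P[]. Qed.

Lemma exists_cover x y : x < y -> exists2 z, cover x z & z <= y.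
Proof.
move=> xy; pose R z := (x < z <= y); have Ry : R y by rewrite /R xy lexx.
(* Among the elements above [x] and at most [y], one with the smallest principal downset covers
   [x]. *)
case: (arg_minnP (fun z => #|[set t | t <= z]|) Ry) => z /andP[xz zy] minz.
exists z => //; rewrite /covered_in !in_setT xz /=.
apply/forall_inP => t _; apply/negP => /andP[xt tz].
have /minz : R t by rewrite /R xt (le_trans (ltW tz) zy).
apply/negP; rewrite -ltnNge; apply: proper_card; apply/properP; split.
  by apply/subsetP => u; rewrite !inE => /le_trans; apply; apply: ltW.
by exists z; rewrite !inE // lt_geF.
Qed.

Lemma cover_path x y : x <= y -> exists2 p, path cover x p & last x p = y.
Proof.
have [n] := ubnP #|[set t | x < t]|; elim: n x => // n IHn x lt_n.
rewrite le_eqVlt => /predU1P[-> | /exists_cover[z xz zy]]; first by exists [::].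
have [|p zp lp] := IHn z _ zy; last by exists (z :: p); rewrite //= xz.
apply: leq_trans (ltnSE lt_n); apply/proper_card/properP; split.
  by apply/subsetP => u; rewrite !inE; apply/lt_trans/cover_lt.
by exists z; rewrite !inE ?ltxx ?cover_lt.
Qed.

(** * Upsets of dimension one as connected cuts *)

Section Cuts.

Variables (e : rel P) (Q : {set P}).
(** Satisfied by the whole poset ([hasse_setT]) and by each block ([hasse_block]) with the same [e],
    so one criterion serves both. *)
Hypothesis (hasse_e : adj (hasse Q) =2 within e Q).

Lemma cc_eq1 S : S \subset Q -> S != set0 -> (cc Q S == 1%N) = linked e S.
Proof.
move=> sSQ S0; have V : vertices (induced (hasse Q) S) = S by exact/setIidPr.
have eS : adj (induced (hasse Q) S) =2 within e S.
  move=> x y; rewrite adj_induced /= hasse_e /=.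
  have [xS | //] := boolP (x \in S); have [yS | //] := boolP (y \in S).
  by rewrite !(subsetP sSQ).
have n1 := @num_components1 _ (induced (hasse Q) S); rewrite V in n1.
apply/idP/linkedP => [/(n1 S0) H x y xS yS | H].
  by rewrite -(eq_connect eS) H.
by apply/(n1 S0) => x y xS yS; rewrite (eq_connect eS) H.
Qed.

(** If [A] or its complement is empty, the counts are 0 and 1, as [Q] is connected. Otherwise both
    are positive, and they add up to 2 exactly when both are 1. *)
Lemma upset_dim_eq1 A : Q != set0 -> linked e Q -> A \subset Q ->
  upset_dim Q A = 1%R <->
  [/\ A != set0, Q :\: A != set0, linked e A & linked e (Q :\: A)].
Proof.
move=> Q0 lQ sAQ; have sDQ : Q :\: A \subset Q by apply: subsetDl.
have cc0 : cc Q set0 = 0%N by apply: num_components0; rewrite /= setI0.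
have cc_gt0 S : S \subset Q -> S != set0 -> (0 < cc Q S)%N.
  by move=> sSQ S0; apply: num_components_gt0; rewrite /= (setIidPr sSQ).
have ccQ : cc Q Q = 1%N by apply/eqP; rewrite cc_eq1.
apply: (iff_trans (B := (cc Q A + cc Q (Q :\: A) = 2)%N)).
  rewrite /upset_dim; split=> [/eqP | ->] //.
  by rewrite subr_eq => /eqP[].
have [-> | A0] := eqVneq A set0.
  by rewrite setD0 cc0 ccQ; split=> // -[].
have [D0 | D0] := eqVneq (Q :\: A) set0.
  have -> : A = Q by apply/eqP; rewrite eqEsubset sAQ -setD_eq0 D0 /=.
  by rewrite setDv cc0 ccQ; split=> // -[].
rewrite -!cc_eq1 //; split=> [ccAD | [_ _ /eqP-> /eqP->] //].
move: (cc_gt0 _ sAQ A0) (cc_gt0 _ sDQ D0) ccAD.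
case: (cc Q A) => [|[|m]] // _; case: (cc Q (Q :\: A)) => [|[|n]] // _.
all: by rewrite ?addSn ?addnS.
Qed.

End Cuts.

Lemma hasse_setT : adj (hasse [set: P]) =2 within hadj [set: P].
Proof. by move=> x y; rewrite /= !in_setT. Qed.

Lemma hadj_sym : symmetric hadj.
Proof. exact: adj_sym. Qed.

(** * Blocks as subposets *)

Section BlockSubposet.

Variable B : {set P}.
Hypothesis blB : block hadj B.

(** A chain of covers from [x] through [z] to [y] is strictly increasing, hence a simple path, hence
    an ear. *)
Lemma block_convex x y z : x \in B -> y \in B -> x < z < y -> z \in B.
Proof.
move=> xB yB /andP[xz zy].
have [p xp lp] := cover_path (ltW xz); have [q zq lq] := cover_path (ltW zy).
have pq : path cover x (p ++ q) by rewrite cat_path xp lp.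
have l_pq : last x (p ++ q) = y by rewrite last_cat lp.
have sub : {subset x :: (p ++ q) <= B}.
  apply: (block_ear hadj_sym blB); rewrite ?l_pq //.
  - exact: sub_path cover_adj _ _ pq.
  - by apply: lt_sorted_uniq; apply: (sub_path cover_lt pq).
  by rewrite lt_eqF // (lt_trans xz).
by apply: sub; rewrite -cat_cons mem_cat -lp mem_last.
Qed.

(** By convexity, anything strictly between two elements of [B] is in [B], so covers in [B] are
    covers in [P]. *)
Lemma hasse_block : adj (hasse B) =2 within hadj B.
Proof.
move=> x y; rewrite /= !adj_hasse.
have [xB | xB] := boolP (x \in B); last first.
  by rewrite /covered_in (negPf xB) /= andbF.
have [yB | yB] := boolP (y \in B); last first.
  by rewrite /covered_in (negPf yB) /= andbF.
suff H u v : u \in B -> v \in B -> covered_in B u v = cover u v by rewrite !H.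
move=> uB vB; rewrite /covered_in uB vB !in_setT /=; congr (_ && _).
apply/forall_inP/forall_inP => H z; last by move=> _; apply: H; rewrite in_setT.
by move=> _; apply/negP => uzv; have/negP := H z (block_convex uB vB uzv).
Qed.

Lemma block_neq0 : B != set0.
Proof. by case/and3P: (block_bicon blB). Qed.

End BlockSubposet.

(** * Transfer of labelings between [P] and its blocks *)

Hypothesis P_linked : linked hadj [set: P].
Hypothesis P_neq0 : [set: P] != set0.

(** Along a chain of covers, each step either keeps the anchor or is an edge of [B], where [A] is
    closed upwards. *)
Lemma anchor_upset B A : block hadj B -> is_upset B A ->
  is_upset [set: P] [set z | anchor hadj B z \in A].
Proof.
move=> blB [sAB upA]; split=> [|x y xA _ xy]; first exact: subsetT.
have [p xp <-] := cover_path xy; elim: p x xp xA {xy} => [|z p IHp] x //=.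
case/andP=> xz zp xA; apply: IHp zp _; rewrite !inE in xA *.
have [<- // | [xB zB ex ez]] :=
  anchor_edge hadj_sym blB P_linked (cover_adj xz).
by rewrite ez; apply: upA zB (ltW (cover_lt xz)); rewrite -ex.
Qed.

Lemma gorenstein_block B (r : int) : block hadj B ->
  has_gorenstein_labeling [set: P] r -> has_gorenstein_labeling B r.
Proof.
move=> blB [phi [phi0 phi1]]; pose rho := anchor hadj B.
have rho_sum A : A \subset B ->
    (\sum_(v in A) \sum_(z | rho z == v) phi z =
     \sum_(z in [set z | rho z \in A]) phi z)%R.
  move=> sAB; rewrite [RHS](partition_big rho (mem A)) /= => [|z]; last first.
    by rewrite inE.
  apply: eq_bigr => v vA; apply: eq_bigl => z; rewrite inE.
  by case: eqP => [->|]; rewrite ?vA ?andbF.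
(* Each [v] receives the total label of the part of [P] hanging at it. *)
exists (fun v => \sum_(z | rho z == v) phi z)%R; split.
  rewrite rho_sum //; apply: etrans phi0; apply: eq_bigl => z.
  by rewrite !inE (anchor_in blB P_linked).
move=> A upA; have sAB := upA.1.
move/(upset_dim_eq1 (hasse_block blB) (block_neq0 blB) (block_linked blB) sAB).
case=> A0 D0 lA lD; rewrite rho_sum // phi1 //; first exact: anchor_upset.
have rhoE := linked_anchor_preim hadj_sym blB P_linked.
have pre0 S : S \subset B -> S != set0 -> [set z | rho z \in S] != set0.
  move=> sSB /set0Pn[v vS]; apply/set0Pn; exists v; rewrite inE.
  by rewrite /rho (anchor_id hadj_sym) // (subsetP sSB).
have DE : [set: P] :\: [set z | rho z \in A] = [set z | rho z \in B :\: A].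
  by apply/setP => z; rewrite !inE andbT (anchor_in blB P_linked) andbT.
apply/(upset_dim_eq1 hasse_setT P_neq0 P_linked (subsetT _)).
rewrite DE; split; [exact: pre0 | | exact: rhoE | ].
  by apply: pre0 => //; apply: subsetDl.
by apply: rhoE => //; apply: subsetDl.
Qed.

Lemma gorenstein_of_blocks (r : int) :
  (forall B, block hadj B -> has_gorenstein_labeling B r) ->
  has_gorenstein_labeling [set: P] r.
Proof.
move=> H; have [F FP] : exists F : {set P} -> P -> int,
    forall B, block hadj B -> gorenstein_labeling B r (F B).
  pose good B f := block hadj B -> gorenstein_labeling B r f.
  apply: (fin_all_exists (P := good)) => B; rewrite {}/good.
  have [/H[phi phiP] | nB] := boolP (block hadj B).
    by exists phi.
  (* A set that is not a block gets a dummy labeling, of which nothing is asked. *)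
  by exists (fun=> 0%R).
pose phi z : int := (\sum_(B | block hadj B && (z \in B)) F B z)%R.
have phi_sum A : (\sum_(z in A) phi z =
    \sum_(B | block hadj B) \sum_(z in A :&: B) F B z)%R.
  rewrite /phi (exchange_big_dep (block hadj)) /= => [|z B _ /andP[] //].
  by apply: eq_bigr => B blB; apply: eq_bigl => z; rewrite inE blB.
exists phi; split.
  rewrite phi_sum big1 // => B blB; rewrite setTI.
  by case: (FP B blB).
move=> A upA /(upset_dim_eq1 hasse_setT P_neq0 P_linked upA.1).
rewrite setTD => -[/set0Pn[x xA] /set0Pn[y yA] lA lC]; rewrite inE in yA.
(* Some edge crosses the cut; its block [B0] will carry the whole sum [r]. *)
have [a [a' [aa' _ _ aA aA']]] :=
  linked_cross P_linked (in_setT x) (in_setT y) xA yA.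
have [B0 [bl0 aB aB']] := block_edge hadj_sym aa'.
rewrite phi_sum (bigD1 B0) //= [X in (_ + X)%R]big1 ?addr0 => [|B /andP[blB nB]].
  (* The trace of [A] on [B0] is an upset with both sides connected, and nonempty because of [a] and
     [a']. *)
  have [_ FP1] := FP B0 bl0; apply: FP1.
    split=> [|u v /setIP[uA uB] vB uv]; first exact: subsetIr.
    by rewrite inE vB andbT; apply: upA.2 uA _ uv; rewrite in_setT.
  apply/(upset_dim_eq1 (hasse_block bl0) (block_neq0 bl0) (block_linked bl0)
    (subsetIr _ _)).
  have -> : B0 :\: A :&: B0 = ~: A :&: B0.
    by apply/setP => z; rewrite !inE; case: (z \in B0); rewrite ?andbT ?andbF.
  split; try exact: (linked_setI_block hadj_sym).
    by apply/set0Pn; exists a; rewrite inE aA.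
  by apply/set0Pn; exists a'; rewrite !inE aA'.
have [FB0 _] := FP B blB.
have [sBA | /subsetPn[v vB vA]] := boolP (B \subset A).
  by rewrite (setIidPr sBA).
(* If [B], not inside [A], also met [A], one of its edges would cross the cut and hence lie in [B0],
   forcing [B = B0]; so the sum is empty. *)
rewrite big1 // => u /setIP[uA uB]; case/eqP: nB.
have [b [b' [bb' bB bB' bA bA']]] :=
  linked_cross (block_linked blB) uB vB uA vA.
have /andP[b0 b0'] := block_of_bond hadj_sym lA lC aA aA' bl0 aB aB' bA bA' bb'.
apply: (block_eq hadj_sym blB bl0 (x := b) (y := b')) => //.
by apply: contraNneq bA' => <-.
Qed.

End Hasse.

Theorem theorem4p3 (d : Order.disp_t) (P : finPOrderType d) (r : int)
    (card_P : (2 <= #|P|)%N)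
    (conn_P : connected_graph (hasse [set: P]))
    (r_gt0 : (0 < r)%R) :
  has_gorenstein_labeling [set: P] r <->
  (forall B : graph P, is_block (hasse [set: P]) B ->
     has_gorenstein_labeling (vertices B) r).
Proof.
have total : vertices (hasse [set: P]) = [set: P] by [].
have [P0 cP] := conn_P; have lP : linked (adj (hasse [set: P])) [set: P].
  apply/linkedP => x y xP yP.
  by rewrite -(eq_connect (@hasse_setT _ P)); apply: cP.
split=> [gP B /(is_block_vertices total) blB | H].
  exact: gorenstein_block.
apply: gorenstein_of_blocks => // B blB.
by have := H _ (block_is_block total blB); rewrite /= setTI.
Qed.
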